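(* Let $p\in\mathbb{N}^k$ and $q\in\mathbb{N}^\ell$ with $m=\sum_{i=1}^k p_i$ and $n=\sum_{j=1}^\ell q_j$, let $\sigma\in\{0,1\}^{k\times \ell}$ be a block sparsity structure, and suppose that $\ell=1$. The data $(U_-,X)$ are informative for quadratic stabilization with feedback gain $K\in\mathcal{M}_{p,q}^\sigma$ if and only if there exist $P\in\mathbb{R}^{n\times n}$ with $P>0$, $L\in\mathcal{M}_{p,q}^\sigma$, $\alpha\geq 0$ and $\beta>0$ such that $$\begin{bmatrix} P-\beta I & 0 & BL\\ 0 & 0 & P\\ L^\top B^\top & P & P\end{bmatrix}-\alpha\begin{bmatrix} N & 0\\ 0 & 0\end{bmatrix}\geq 0,$$ where $N\in\mathbb{R}^{2n\times 2n}$ occupies the upper-left $2n\times 2n$ block.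
   Context: All matrices are real; $P>0$ (resp. $\geq 0$, $<0$) means symmetric positive definite (resp. positive semidefinite, negative definite). System: $x(t+1)=A_sx(t)+Bu(t)+w(t)$ with $x(t),w(t)\in\mathbb{R}^n$, $u(t)\in\mathbb{R}^m$. It is the aggregate of $r$ agents with state and input dimensions $n_i,m_i$ ($n=\sum n_i$, $m=\sum m_i$), and $B=\mathrm{diag}(B_1,\dots,B_r)\in\mathbb{R}^{n\times m}$ with $B_i\in\mathbb{R}^{n_i\times m_i}$. $B$ is known, $A_s\in\mathbb{R}^{n\times n}$ is unknown. Data: on a time window of length $T$ one measures $X=[x(0)\ \cdots\ x(T)]$ and $U_-=[u(0)\ \cdots\ u(T-1)]$; set $X_+=[x(1)\ \cdots\ x(T)]$, $X_-=[x(0)\ \cdots\ x(T-1)]$. The noise matrix $W_-=[w(0)\ \cdots\ w(T-1)]$ is not measured, but is assumed to satisfy $$\begin{bmatrix} I\\ W_-^\top\end{bmatrix}^\top\Phi\begin{bmatrix} I\\ W_-^\top\end{bmatrix}\geq 0,\qquad \Phi=\begin{bmatrix}\Phi_{11}&\Phi_{12}\\ \Phi_{12}^\top&\Phi_{22}\end{bmatrix}\qquad( * )$$ for a given matrix $\Phi$ with $\Phi_{11}=\Phi_{11}^\top\in\mathbb{R}^{n\times n}$, $\Phi_{12}\in\mathbb{R}^{n\times T}$, $\Phi_{22}=\Phi_{22}^\top\in\mathbb{R}^{T\times T}$, $\Phi_{22}<0$. The data are generated by the true system $(A_s,B)$ with noise satisfying $( * )$. The set of state matrices compatible with the data is $\Sigma=\{A\in\mathbb{R}^{n\times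 n}\mid W_-=X_+-AX_--BU_-\text{ satisfies }( * )\}$; in particular $A_s\in\Sigma$. Define $$N:=\begin{bmatrix} I & X_+-BU_-\\ 0&-X_-\end{bmatrix}\Phi\begin{bmatrix} I & X_+-BU_-\\ 0&-X_-\end{bmatrix}^\top .$$ Block structures: for $p\in\mathbb{N}^k$, $q\in\mathbb{N}^\ell$ with $m=\sum p_i$, $n=\sum q_j$, a matrix $M\in\mathbb{R}^{m\times n}$ is partitioned into blocks $M_{ij}\in\mathbb{R}^{p_i\times q_j}$, $1\le i\le k$, $1\le j\le\ell$. A block sparsity structure is a matrix $\sigma\in\{0,1\}^{k\times\ell}$, and $\mathcal{M}_{p,q}^\sigma:=\{M\in\mathbb{R}^{m\times n}\mid M_{ij}=0\text{ if }\sigma_{ij}=0\}$. Definition: the data $(U_-,X)$ are informative for quadratic stabilization with feedback gain $K\in\mathcal{M}_{p,q}^\sigma$ if there exist $K\in\mathcal{M}_{p,q}^\sigma$ and a matrix $P>0$ such that $(A+BK)P(A+BK)^\top<P$ for every $A\in\Sigma$. *)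

(* Defs.v *)
From HB Require Import structures.
From mathcomp Require Import all_boot all_order all_algebra.
From mathcomp Require Import reals.

Set Implicit Arguments.
Unset Strict Implicit.
Unset Printing Implicit Defensive.

Import Order.TTheory GRing.Theory Num.Theory.
Local Open Scope ring_scope.

Section Definiteness.
Variables (R : realType) (n : nat).
Implicit Types M : 'M[R]_n.

Definition psd M : Prop :=
  M^T = M /\ forall v : 'cV[R]_n, 0 <= (v^T *m M *m v) ord0 ord0.

Definition posdef M : Prop :=
  M^T = M /\ forall v : 'cV[R]_n, v != 0 -> 0 < (v^T *m M *m v) ord0 ord0.

Definition negdef M : Prop := posdef (- M).

End Definiteness.

Section Blocks.
Variables (R : realType) (m n k l : nat) (p : 'I_k -> nat) (q : 'I_l -> nat).
Hypotheses (hm : (\sum_i p i)%N = m) (hn : (\sum_j q j)%N = n).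

(* M_ij, of size p i x q j; the cast only rewrites the dimensions m and n of M
   as the sums on which [submxblock] operates. *)
Definition block (M : 'M[R]_(m, n)) (i : 'I_k) (j : 'I_l) : 'M[R]_(p i, q j) :=
  submxblock (castmx (esym hm, esym hn) M) i j.

(* [true] and [false] stand for the entries 1 and 0 of the sparsity structure. *)
Definition has_sparsity (sigma : 'M[bool]_(k, l)) (M : 'M[R]_(m, n)) : Prop :=
  forall i j, sigma i j = false -> block M i j = 0.

End Blocks.

(* B = diag(B_1, ..., B_r), where B_i is the (possibly rectangular)
   block (i, i) of B. *)
Definition block_diagonal (R : realType) (m n r : nat)
    (ns ms : 'I_r -> nat) (hn : (\sum_i ns i)%N = n) (hm : (\sum_i ms i)%N = m)
    (B : 'M[R]_(n, m)) : Prop :=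
  forall i j, i != j -> block hn hm B i j = 0.

Section Data.
Variables (R : realType) (n m T : nat).

(* [z(0) ... z(N-1)] *)
Definition samples (d N : nat) (z : nat -> 'cV[R]_d) : 'M[R]_(d, N) :=
  \matrix_(i < d, t < N) z t i ord0.

(* X_+ and X_- drop the first, respectively the last, column of
   X = [x(0) ... x(T)]. *)
Definition Xplus (X : 'M[R]_(n, T.+1)) : 'M[R]_(n, T) :=
  colsub (lift ord0) X.

Definition Xminus (X : 'M[R]_(n, T.+1)) : 'M[R]_(n, T) :=
  colsub (lift ord_max) X.

Definition noise_bound (Phi : 'M[R]_(n + T)) (W : 'M[R]_(n, T)) : Prop :=
  psd ((col_mx 1%:M W^T)^T *m Phi *m col_mx 1%:M W^T).

Variables (Phi : 'M[R]_(n + T)) (B : 'M[R]_(n, m)).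
Variables (U : 'M[R]_(m, T)) (X : 'M[R]_(n, T.+1)).

(* A \in Sigma *)
Definition compatible (A : 'M[R]_n) : Prop :=
  noise_bound Phi (Xplus X - A *m Xminus X - B *m U).

Definition dataN : 'M[R]_(n + n) :=
  let G : 'M[R]_(n + n, n + T) :=
    block_mx 1%:M (Xplus X - B *m U) 0 (- Xminus X) in
  G *m Phi *m G^T.

Definition informative (k l : nat) (p : 'I_k -> nat) (q : 'I_l -> nat)
    (hp : (\sum_i p i)%N = m) (hq : (\sum_j q j)%N = n)
    (sigma : 'M[bool]_(k, l)) : Prop :=
  exists (K : 'M[R]_(m, n)) (P : 'M[R]_n),
    [/\ has_sparsity hp hq sigma K, posdef P &
      forall A : 'M[R]_n, compatible A ->
        posdef (P - (A + B *m K) *m P *m (A + B *m K)^T)].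

Definition lmi (P : 'M[R]_n) (L : 'M[R]_(m, n)) (alpha beta : R) :
    'M[R]_((n + n) + n) :=
  block_mx (block_mx (P - beta%:M) 0
                     0             0) (col_mx (B *m L) P)
           (row_mx (L^T *m B^T) P)    P
  - alpha *: block_mx dataN 0
                      0     0.

End Data.

(* Main.v *)
Require Import Defs.
From HB Require Import structures.
From mathcomp Require Import all_boot all_order all_algebra.
From mathcomp Require Import reals.
From mathcomp Require Import ring lra.
From mathcomp Require Import boolp classical_sets topology normedtype derive.
Import numFieldNormedType.Exports.

Set Implicit Arguments.
Unset Strict Implicit.
Unset Printing Implicit Defensive.

Import Order.TTheory GRing.Theory Num.Theory.
Local Open Scope ring_scope.

(** Write [N] for the data matrix.  The compatible matrices [A] are those whose
    graphs [(v, A^T v)] lie in the cone [N >= 0], and [K] stabilizes all of them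
    with certificate [P] exactly when the Lyapunov form
    [M(a, b) = P(a) - P((BK)^T a + b)] is positive on each of these graphs, away
    from [v = 0].  The LMI with [L = K P] says, after a Schur complement on the
    block [P] in the last position, that [M - alpha N >= beta |a|^2]
    ([qform_lmi]).  Evaluating this on a graph gives sufficiency at once
    ([lmi_stabilizes]).

    Necessity ([stabilizing_lmi]) is a matrix-valued S-lemma.  The graphs fill
    the cone: each [(a, b)] with [a <> 0] and [N(a, b) >= 0] is on the graph of
    some compatible [A] ([qmi_interpolation]), obtained from the completed square
    [N(a, b) = S(a) - |b - Z a|^2], the norm being that of the negated lower right
    block of [N], by a correction [Z + D] with [D] of rank one, admissible by
    Cauchy-Schwarz.  That block is negative definite because a
    direction [b] killed by [X_-^T] could be added freely to a compatible [A], and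
    the closed loop would then be unbounded ([Xminus_ker_trivial]).  So [M] is positive on
    all nonzero vectors of the cone [N >= 0], and the strict S-lemma for two
    quadratic forms ([strict_s_lemma]) provides the multiplier [alpha] and the margin [beta].

    Finally, a pattern with one block column only prescribes zero rows of [K],
    and zero rows survive multiplication on the right by [P] or by its
    inverse ([has_sparsity_mulr]); the change of variable [L = K P] therefore
    preserves the pattern. *)

(** * Bilinear and quadratic forms of matrices *)

Definition bform (R : realType) (p q : nat) (M : 'M[R]_(p, q))
    (u : 'cV[R]_p) (v : 'cV[R]_q) : R := (u^T *m M *m v) ord0 ord0.

Notation qform M v := (bform M v v).

Section BilinearForms.
Variable R : realType.

Lemma bformDl p q (M : 'M[R]_(p, q)) u1 u2 v :
  bform M (u1 + u2) v = bform M u1 v + bform M u2 v.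
Proof. by rewrite /bform linearD /= !mulmxDl mxE. Qed.

Lemma bformDr p q (M : 'M[R]_(p, q)) u v1 v2 :
  bform M u (v1 + v2) = bform M u v1 + bform M u v2.
Proof. by rewrite /bform mulmxDr mxE. Qed.

Lemma bformZl p q (M : 'M[R]_(p, q)) c u v : bform M (c *: u) v = c * bform M u v.
Proof. by rewrite /bform linearZ /= -!scalemxAl mxE. Qed.

Lemma bformZr p q (M : 'M[R]_(p, q)) c u v : bform M u (c *: v) = c * bform M u v.
Proof. by rewrite /bform -scalemxAr mxE. Qed.

Lemma bform0l p q (M : 'M[R]_(p, q)) v : bform M 0 v = 0.
Proof. by rewrite /bform trmx0 !mul0mx mxE. Qed.

Lemma bform0r p q (M : 'M[R]_(p, q)) u : bform M u 0 = 0.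
Proof. by rewrite /bform mulmx0 mxE. Qed.

Lemma bform0 p q u v : bform (0 : 'M[R]_(p, q)) u v = 0.
Proof. by rewrite /bform mulmx0 mul0mx mxE. Qed.

Lemma bformNl p q (M : 'M[R]_(p, q)) u v : bform M (- u) v = - bform M u v.
Proof. by rewrite -scaleN1r bformZl mulN1r. Qed.

Lemma bformNr p q (M : 'M[R]_(p, q)) u v : bform M u (- v) = - bform M u v.
Proof. by rewrite -scaleN1r bformZr mulN1r. Qed.

Lemma bform_add p q (M N : 'M[R]_(p, q)) u v :
  bform (M + N) u v = bform M u v + bform N u v.
Proof. by rewrite /bform mulmxDr mulmxDl mxE. Qed.

Lemma bform_scale p q c (M : 'M[R]_(p, q)) u v : bform (c *: M) u v = c * bform M u v.
Proof. by rewrite /bform -scalemxAr -scalemxAl mxE. Qed.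

Lemma bform_opp p q (M : 'M[R]_(p, q)) u v : bform (- M) u v = - bform M u v.
Proof. by rewrite -scaleN1r bform_scale mulN1r. Qed.

Lemma bform_scalar d c (u v : 'cV[R]_d) : bform c%:M u v = c * bform 1%:M u v.
Proof. by rewrite -bform_scale scalemx1. Qed.

Lemma bform_tr p q (M : 'M[R]_(p, q)) u v : bform M^T v u = bform M u v.
Proof.
rewrite /bform; have -> : v^T *m M^T *m u = (u^T *m M *m v)^T by rewrite !trmx_mul trmxK mulmxA.
exact: mxE.
Qed.

Lemma bform_mul p q p' q' (F : 'M[R]_(p', p)) (M : 'M[R]_(p, q)) (G : 'M[R]_(q, q'))
    u v : bform (F *m M *m G) u v = bform M (F^T *m u) (G *m v).
Proof. by rewrite /bform trmx_mul trmxK !mulmxA. Qed.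

Lemma bform_mull p q p' (F : 'M[R]_(p', p)) (M : 'M[R]_(p, q)) u v :
  bform (F *m M) u v = bform M (F^T *m u) v.
Proof. by rewrite /bform trmx_mul trmxK !mulmxA. Qed.

Lemma bform_mulr p q q' (M : 'M[R]_(p, q)) (G : 'M[R]_(q, q')) u v :
  bform (M *m G) u v = bform M u (G *m v).
Proof. by rewrite /bform !mulmxA. Qed.

Lemma bform_block p1 p2 q1 q2 (A : 'M[R]_(p1, q1)) (B : 'M[R]_(p1, q2))
    (C : 'M[R]_(p2, q1)) (D : 'M[R]_(p2, q2)) a b c d :
  bform (block_mx A B C D) (col_mx a b) (col_mx c d) =
  bform A a c + bform B a d + (bform C b c + bform D b d).
Proof.
rewrite /bform tr_col_mx mul_row_block mul_row_col !mulmxDl !mxE.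
by rewrite addrACA.
Qed.

Lemma bform_col p1 p2 q (A : 'M[R]_(p1, q)) (B : 'M[R]_(p2, q)) a b v :
  bform (col_mx A B) (col_mx a b) v = bform A a v + bform B b v.
Proof. by rewrite /bform tr_col_mx mul_row_col mulmxDl mxE. Qed.

Lemma bform_row p q1 q2 (A : 'M[R]_(p, q1)) (B : 'M[R]_(p, q2)) u a b :
  bform (row_mx A B) u (col_mx a b) = bform A u a + bform B u b.
Proof. by rewrite /bform mul_mx_row mul_row_col mxE. Qed.

Lemma bformC d (M : 'M[R]_d) : M^T = M -> forall u v, bform M u v = bform M v u.
Proof. by move=> symM u v; rewrite -bform_tr symM. Qed.

Lemma qform_pencil d (M : 'M[R]_d) t u v :
  qform M (u + t *: v) =
  qform M u + t * (bform M u v + bform M v u) + t ^+ 2 * qform M v.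
Proof. by rewrite !(bformDl, bformDr, bformZl, bformZr); ring. Qed.

Lemma qformZ d (M : 'M[R]_d) c v : qform M (c *: v) = c ^+ 2 * qform M v.
Proof. by rewrite bformZl bformZr mulrA. Qed.

Lemma qform1E d (v : 'cV[R]_d) : qform 1%:M v = \sum_i v i ord0 ^+ 2.
Proof. by rewrite /bform mulmx1 mxE; apply: eq_bigr => i _; rewrite mxE. Qed.

Lemma qform1_ge0 d (v : 'cV[R]_d) : 0 <= qform 1%:M v.
Proof. by rewrite qform1E sumr_ge0 // => i _; exact: sqr_ge0. Qed.

Lemma qform1_gt0 d (v : 'cV[R]_d) : v != 0 -> 0 < qform 1%:M v.
Proof.
move=> v0; rewrite lt_def qform1_ge0 andbT qform1E; apply: contraNN v0.
rewrite psumr_eq0 => [/allP v0|i _]; last exact: sqr_ge0.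
apply/eqP/matrixP => i j; rewrite ord1 mxE; apply/eqP.
by have := v0 i (mem_index_enum _); rewrite /= sqrf_eq0.
Qed.

(** The degenerate case [S(u) = 0] is kept: there [S] nonnegative along
    the line [v + t u] forces [S(u, v) = 0]. *)
Lemma cauchy_schwarz d (S : 'M[R]_d) (u v : 'cV[R]_d) :
  S^T = S -> (forall w, 0 <= qform S w) ->
  bform S u v ^+ 2 <= qform S u * qform S v.
Proof.
move=> symS S_ge0; have Cuv := bformC symS u v.
have [u0|u0] := eqVneq (qform S u) 0.
  have [->|b0] := eqVneq (bform S u v) 0; first by rewrite expr0n u0 mul0r.
  have := S_ge0 (v + (- (qform S v + 1) / (bform S u v *+ 2)) *: u).
  rewrite qform_pencil u0 -Cuv mulr0 addr0 -mulr2n mulfVK ?mulrn_eq0 //.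
  by rewrite opprD addrA addrN add0r ler0N1.
have {u0}u_gt0 : 0 < qform S u by rewrite lt_def u0 S_ge0.
have := S_ge0 (qform S u *: v + (- bform S u v) *: u).
rewrite qform_pencil !(bformZl, bformZr) -Cuv => h.
have : 0 <= qform S u * (qform S u * qform S v - bform S u v ^+ 2) by lra.
by rewrite pmulr_rge0 // subr_ge0.
Qed.

Lemma posdef_unitmx d (P : 'M[R]_d) : posdef P -> P \in unitmx.
Proof.
case=> symP P_gt0; rewrite -row_free_unit -kermx_eq0; apply/rowV0P => v.
move/sub_kermxP => vP; apply/eqP; apply: contraT => v0.
have /P_gt0 : v^T != 0 by rewrite -(inj_eq (@trmx_inj _ _ _)) trmxK trmx0.
by rewrite trmxK vP mul0mx mxE ltxx.
Qed.

Lemma posdef_ge0 d (P : 'M[R]_d) v : posdef P -> 0 <= qform P v.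
Proof.
by case=> _ P_gt0; have [->|/P_gt0/ltW//] := eqVneq v 0; rewrite bform0l.
Qed.

End BilinearForms.

(** * The strict S-lemma *)

Section SLemma.
Variable R : realType.

Lemma continuous_qform d (M : 'M[R]_d) :
  continuous (fun r : 'rV[R]_d => qform M r^T).
Proof.
have -> : (fun r : 'rV[R]_d => qform M r^T) =
    (fun r => \sum_i \sum_j r ord0 i * M i j * r ord0 j).
  apply/funext => r; rewrite /bform trmxK mxE.
  rewrite exchange_big /=; apply: eq_bigr => j _.
  by rewrite mxE mxE big_distrl.
have cc i : continuous (fun r : 'rV[R]_d => r ord0 i) by exact: coord_continuous.
apply: continuous_big => [|i _]; first exact: add_continuous.
apply: continuous_big => [|j _]; first exact: add_continuous.
move=> r; apply: (@cvgM _ _ (nbhs r)); last exact: cc.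
by apply: cvgM; [exact: cc|exact: cvg_cst].
Qed.

(** By homogeneity the best [mu] is the minimum of [f] over the unit sphere;
    as it is attained, it is positive when [f] is. *)
Lemma homogeneous_lower_bound d (f : 'rV[R]_d -> R) :
  continuous f -> (forall c r, f (c *: r) = c ^+ 2 * f r) ->
  exists2 mu, forall r, mu * qform 1%:M r^T <= f r &
    (forall r, r != 0 -> 0 < f r) -> 0 < mu.
Proof.
move=> f_cont f_hom.
have f0 : f 0 = 0 by rewrite -(scale0r 0) f_hom expr0n mul0r.
pose S := [set r : 'rV[R]_d | qform 1%:M r^T = 1]%classic.
have S_unit r : r != 0 -> exists2 c, 0 < c & S (c *: r).
  move=> r0; have q_gt0 : 0 < qform 1%:M r^T.
    by apply: qform1_gt0; rewrite -(inj_eq (@trmx_inj _ _ _)) trmxK trmx0.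
  exists (Num.sqrt (qform 1%:M r^T))^-1; first by rewrite invr_gt0 sqrtr_gt0.
  rewrite /S /= linearZ /= qformZ exprVn sqr_sqrtr ?(ltW q_gt0) //.
  by rewrite mulVf // gt_eqF.
have [S0|/set0P Sne] := eqVneq S set0.
  exists 1 => // r; have [->|/S_unit[c _]] := eqVneq r 0; last by rewrite S0.
  by rewrite f0 trmx0 bform0l mulr0.
have S_compact : compact S.
  have S_closed : closed S.
    have /continuous_closedP q_closed := @continuous_qform d 1%:M.
    by apply: (q_closed [set 1]%classic); exact: closed_eq.
  apply: (subclosed_compact S_closed).
    apply: (@rV_compact R d (fun=> `[-1, 1]%classic)) => i.
    exact: segment_compact.
  move=> r /= Sr i; rewrite in_itv /= -ler_norml -[leRHS]sqrtr1 -sqrtr_sqr.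
  apply: ler_wsqrtr; rewrite -Sr qform1E (bigD1 i) //= mxE lerDl.
  by rewrite sumr_ge0 // => j _; exact: sqr_ge0.
have [c /set_mem Sc min_c] := EVT_min_rV Sne S_compact (continuous_subspaceT f_cont).
exists (f c) => [r|f_gt0]; last first.
  apply: f_gt0; apply/eqP => c0; move: Sc.
  by rewrite /S /= c0 trmx0 bform0l => /esym/eqP; rewrite oner_eq0.
have [->|/S_unit[t t_gt0 St]] := eqVneq r 0.
  by rewrite f0 trmx0 bform0l mulr0.
have := min_c _ (mem_set St); rewrite f_hom.
move: St; rewrite /S /= linearZ /= qformZ => St fct.
have t2_gt0 : 0 < t ^+ 2 by rewrite exprn_gt0.
by rewrite -(ler_pM2l t2_gt0) mulrCA St mulr1.
Qed.


Lemma qform_lower_bound d (M : 'M[R]_d) :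
  exists mu, forall v, mu * qform 1%:M v <= qform M v.
Proof.
have [c r|mu mu_le _] := homogeneous_lower_bound (@continuous_qform d M).
  by rewrite linearZ /= qformZ.
by exists mu => v; have := mu_le v^T; rewrite trmxK.
Qed.

(** If the inequality failed, the form [N(u) M - M(u) N] would vanish at [u] and
    be negative at [v], hence negative on the whole ray [u + t v], [t > 0], for a
    suitable sign of [v].  That ray meets the cone [N = 0], where the
    hypothesis makes the form positive. *)
Lemma s_lemma_slope d (M N : 'M[R]_d) u v :
  (forall z, z != 0 -> 0 <= qform N z -> 0 < qform M z) ->
  qform N v < 0 -> 0 < qform N u ->
  qform M u * qform N v <= qform M v * qform N u.
Proof.
move=> MN; wlog cross_le0 : v / qform N u * (bform M u v + bform M v u)
    <= qform M u * (bform N u v + bform N v u).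
  move=> hw; have [le|/ltW le] := leP (qform N u * (bform M u v + bform M v u))
    (qform M u * (bform N u v + bform N v u)); first exact: hw.
  have := hw (- v); rewrite !(bformNl, bformNr, opprK) -!opprD !mulrN.
  by rewrite lerN2; apply.
move=> Nv_lt0 Nu_gt0; rewrite leNgt; apply/negP => lt_uv.
(* t is the positive root of N(u + t v) = c + b t + a t^2. *)
set a := qform N v in Nv_lt0 lt_uv *; set c := qform N u in Nu_gt0 lt_uv cross_le0 *.
set b := bform N u v + bform N v u in cross_le0 *.
pose s := Num.sqrt (b ^+ 2 - 4 * a * c).
have ac_lt0 : a * c < 0 by rewrite pmulr_llt0.
have s2 : s ^+ 2 = b ^+ 2 - 4 * a * c.
  by rewrite sqr_sqrtr //; have := sqr_ge0 b; lra.
have b_lt_s : 0 < b + s.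
  have s_ge0 : 0 <= s by exact: sqrtr_ge0.
  rewrite ltNge; apply/negP => bs; nra.
pose t := (b + s) / (- 2 * a).
have a0 : a != 0 by rewrite lt_eqF.
have t_gt0 : 0 < t by rewrite divr_gt0 //; lra.
have root_t : c + t * b + t ^+ 2 * a = 0.
  have -> : c + t * b + t ^+ 2 * a = (s ^+ 2 - (b ^+ 2 - 4 * a * c)) / (4 * a).
    by rewrite /t; field.
  by rewrite s2 subrr mul0r.
have z0 : u + t *: v != 0.
  apply/eqP => /eqP; rewrite addr_eq0 => /eqP uE.
  move: Nu_gt0; rewrite /c uE bformNl bformNr opprK qformZ -/a.
  by rewrite pmulr_rgt0 ?exprn_gt0 // ltNge ltW.
have := MN _ z0; rewrite !qform_pencil -/a -/b -/c root_t lexx => /(_ isT) Mz.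
have := mulr_gt0 Nu_gt0 Mz; have t2 : 0 < t ^+ 2 by rewrite exprn_gt0.
set M1 := qform M u in lt_uv cross_le0 *; set M2 := qform M v in lt_uv *.
set B := bform M u v + _ in cross_le0 *.
have := ler_wpM2l (ltW t_gt0) cross_le0.
have : t ^+ 2 * (M2 * c) < t ^+ 2 * (M1 * a) by rewrite ltr_pM2l.
have : M1 * (c + t * b + t ^+ 2 * a) = 0 by rewrite root_t mulr0.
lra.
Qed.

(** The admissible multipliers lie between the ratios [M / N] taken over [N < 0] and
    those taken over [N > 0]; [s_lemma_slope] puts the former below the latter,
    and the point [u] makes the infimum of the latter finite. *)
Lemma s_lemma_regular d (M N : 'M[R]_d) u :
  (forall z, z != 0 -> 0 <= qform N z -> 0 < qform M z) ->
  0 < qform N u ->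
  exists2 alpha, 0 <= alpha & forall z, alpha * qform N z <= qform M z.
Proof.
move=> MN Nu_gt0.
have pos_neq0 w : 0 < qform N w -> w != 0.
  by apply: contraTneq => ->; rewrite bform0l ltxx.
have M_gt0 w : 0 < qform N w -> 0 < qform M w.
  by move=> Nw; apply: MN (ltW Nw); exact: pos_neq0.
pose E := [set s | exists2 w, 0 < qform N w & s = qform M w / qform N w]%classic.
have E_ne : (E !=set0)%classic by exists (qform M u / qform N u), u.
have E_lb0 : lbound E 0.
  by move=> _ [w Nw ->]; rewrite divr_ge0 ?ltW // M_gt0.
exists (inf E); first exact: lb_le_inf.
move=> z; case: (ltrgt0P (qform N z)) => [Nz|Nz|Nz].
- rewrite -ler_pdivlMr //; apply: ge_inf; last by exists z.
  by exists 0.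
- rewrite -ler_ndivrMr //; apply: lb_le_inf => // _ [w Nw ->].
  rewrite ler_ndivrMr // mulrAC ler_pdivrMr //; exact: s_lemma_slope.
rewrite Nz mulr0; have [->|z0] := eqVneq z 0; first by rewrite bform0l.
by apply/ltW/MN; rewrite ?Nz.
Qed.

(** Compactness makes the hypothesis uniform: [max(M, -N) >= mu |z|^2] with
    [mu > 0].  The hypothesis thus survives the shifts of [M] by [- mu/2] and of [N] by
    [mu/2], and the multiplier found for the shifted pair leaves the margin
    [mu/2].  If the shifted [N] is nowhere positive, then [N] is uniformly
    negative and any large multiplier works. *)
Theorem strict_s_lemma d (M N : 'M[R]_d) :
  (forall z, z != 0 -> 0 <= qform N z -> 0 < qform M z) ->
  exists alpha beta, [/\ 0 <= alpha, 0 < beta &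
    forall z, beta * qform 1%:M z <= qform M z - alpha * qform N z].
Proof.
move=> MN.
pose f (r : 'rV[R]_d) := Num.max (qform M r^T) (qform (- N) r^T).
have [||mu mu_le mu_gt0] := @homogeneous_lower_bound d f.
- by apply: max_fun_continuous; exact: continuous_qform.
- by move=> c r; rewrite /f linearZ /= !qformZ maxr_pMr ?sqr_ge0.
have {}mu_gt0 : 0 < mu.
  apply: mu_gt0 => r r0; rewrite /f lt_max bform_opp oppr_gt0.
  have [Nr|] := leP 0 (qform N r^T); last by rewrite orbT.
  by rewrite MN // -(inj_eq (@trmx_inj _ _ _)) trmxK trmx0.
have {}mu_le z : mu * qform 1%:M z <= qform M z \/ mu * qform 1%:M z <= - qform N z.
  by have := mu_le z^T; rewrite /f le_max trmxK bform_opp => /orP.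
pose N' := N + (mu / 2)%:M; pose M' := M - (mu / 2)%:M.
have N'E z : qform N' z = qform N z + mu / 2 * qform 1%:M z.
  by rewrite bform_add bform_scalar.
have M'E z : qform M' z = qform M z - mu / 2 * qform 1%:M z.
  by rewrite bform_add bform_opp bform_scalar.
have M'N' z : z != 0 -> 0 <= qform N' z -> 0 < qform M' z.
  move=> /qform1_gt0 z_gt0; rewrite N'E M'E.
  have := mulr_gt0 mu_gt0 z_gt0; case: (mu_le z); lra.
(* A Slater point of the shifted form N' decides between the two cases. *)
have [[u Nu]|noslater] := pselect (exists u, 0 < qform N' u).
  have [alpha alpha_ge0 le_alpha] := s_lemma_regular M'N' Nu.
  exists alpha, (mu / 2); split=> // [|z]; first lra.
  have := le_alpha z; rewrite N'E M'E.
  have : 0 <= alpha * (mu / 2 * qform 1%:M z).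
    by rewrite !mulr_ge0 ?qform1_ge0 ?invr_ge0 ?(ltW mu_gt0).
  lra.
have N'_le0 z : qform N' z <= 0.
  by rewrite leNgt; apply/negP => Nz; apply: noslater; exists z.
have [nu nu_le] := qform_lower_bound M.
exists ((`|nu| + 1) / (mu / 2)), 1; split=> // [|z].
  by rewrite divr_ge0 ?addr_ge0 //; lra.
have := N'_le0 z; have := nu_le z; rewrite N'E => nuz Nz.
have q_ge0 := qform1_ge0 z.
have : - `|nu| * qform 1%:M z <= nu * qform 1%:M z.
  by rewrite ler_wpM2r // lerNl ler_normr lexx orbT.
have : (`|nu| + 1) / (mu / 2) * (qform N z + mu / 2 * qform 1%:M z) <= 0.
  by rewrite mulr_ge0_le0 // divr_ge0 ?addr_ge0 //; lra.
rewrite mulrDr mulrA divfK; last by apply/eqP; lra.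
lra.
Qed.

End SLemma.

(** * Interpolation in a quadratic matrix inequality *)

Section QuadraticMatrixInequality.
Variable R : realType.

Lemma rank1_mulE d1 d2 d3 (S : 'M[R]_(d1, d2)) (w : 'cV[R]_d3) a v :
  w *m a^T *m S *m v = bform S a v *: w.
Proof. by rewrite -!mulmxA (mulmxA a^T) [X in w *m X]mx11_scalar mul_mx_scalar. Qed.

(** Completing the square in the second variable. *)
Lemma schur_completion n (N : 'M[R]_(n + n)) :
  N^T = N -> drsubmx N \in unitmx ->
  let Z := - (invmx (drsubmx N) *m dlsubmx N) in
  let S := ulsubmx N - ursubmx N *m invmx (drsubmx N) *m dlsubmx N in
  S^T = S /\ forall a b,
    qform N (col_mx a b) = qform S a + qform (drsubmx N) (b - Z *m a).
Proof.
move=> symN N22_unit Z S.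
have [sym11 sym12 sym22] : [/\ (ulsubmx N)^T = ulsubmx N,
    (ursubmx N)^T = dlsubmx N & (drsubmx N)^T = drsubmx N].
  by rewrite trmx_ulsub trmx_ursub trmx_drsub symN.
split=> [|a b].
  by rewrite /S linearB /= sym11 !trmx_mul trmx_inv sym22 -sym12 trmxK mulmxA.
rewrite -[in LHS](submxK N) bform_block /S /Z mulNmx opprK.
rewrite bform_add bform_opp !(bformDl, bformDr).
set h := invmx _ *m _ *m a.
have N22h : forall v, bform (drsubmx N) v h = bform (dlsubmx N) v a.
  by move=> v; rewrite /h -bform_mulr mulKVmx.
rewrite (bformC sym22 h b) !N22h -(bform_tr (dlsubmx N) h a) -sym12 trmxK.
rewrite -(bform_tr (ursubmx N) a b) -[in X in - X]mulmxA bform_mulr.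
rewrite sym12 -/h; ring.
Qed.

(** With [e = b - Z a] the matrix sought is [A^T = Z + e a^T S / S(a)], and the
    inequality on its graph reads [S(a, v)^2 |e|^2 / S(a)^2 <= S(v)]: this is
    Cauchy-Schwarz, as [|e|^2 <= S(a)].  The matrix [A0] only serves to show that
    the Schur complement [S] is positive semidefinite. *)
Lemma qmi_interpolation n (N : 'M[R]_(n + n)) (A0 : 'M[R]_n) (a b : 'cV[R]_n) :
  N^T = N -> (forall c, c != 0 -> qform N (col_mx 0 c) < 0) ->
  (forall v, 0 <= qform N (col_mx v (A0^T *m v))) ->
  a != 0 -> 0 <= qform N (col_mx a b) ->
  exists2 A : 'M[R]_n, A^T *m a = b &
    forall v, 0 <= qform N (col_mx v (A^T *m v)).
Proof.
move=> symN N22_lt0 A0_ge0 a0 ab_ge0.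
have N22E c : qform N (col_mx 0 c) = qform (drsubmx N) c.
  by rewrite -[in LHS](submxK N) bform_block !(bform0l, bform0r) !add0r.
have N22_neg : posdef (- drsubmx N).
  split; first by rewrite linearN /= trmx_drsub symN.
  by move=> c /N22_lt0; rewrite N22E -oppr_gt0 -bform_opp.
have N22_unit : drsubmx N \in unitmx.
  have := posdef_unitmx N22_neg; rewrite -scaleN1r unitmxZ ?unitrN1 //.
have [symS NE] := schur_completion symN N22_unit.
set Z := - (invmx _ *m _) in NE; set S := ulsubmx N - _ in symS NE.
have N22_le0 c : qform (drsubmx N) c <= 0.
  by rewrite -oppr_ge0 -bform_opp; exact: posdef_ge0.
have S_ge0 v : 0 <= qform S v.
  by have := A0_ge0 v; rewrite NE; have := N22_le0 (A0^T *m v - Z *m v); lra.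
pose e := b - Z *m a; rewrite NE -/e in ab_ge0.
pose s := qform S a.
(* If s = 0 then e = 0, and the convention 0^-1 = 0 leaves A^T = Z. *)
exists ((Z + s^-1 *: (e *m a^T *m S))^T) => [|v]; rewrite trmxK.
  rewrite mulmxDl -scalemxAl rank1_mulE scalerA -/s.
  have [s0|s0] := eqVneq s 0; last by rewrite mulVf // scale1r addrC subrK.
  have e0 : e = 0.
    apply/eqP; apply: contraT => /N22_lt0; rewrite N22E.
    by move: ab_ge0; rewrite -/s s0 add0r => /le_lt_trans h/h; rewrite ltxx.
  by rewrite s0 mulr0 scale0r addr0; apply/esym/eqP; rewrite -subr_eq0 -/e e0.
rewrite NE mulmxDl addrAC subrr add0r -scalemxAl rank1_mulE scalerA qformZ.
have [s0|s0] := eqVneq s 0; first by rewrite s0 invr0 mul0r expr0n mul0r addr0.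
have s_gt0 : 0 < s by rewrite lt_def s0 S_ge0.
have := cauchy_schwarz a v symS S_ge0; rewrite -/s => CS.
rewrite -(pmulr_rge0 _ s_gt0) mulrDr exprMn.
have -> : s * (s^-1 ^+ 2 * bform S a v ^+ 2 * qform (drsubmx N) e) =
    bform S a v ^+ 2 * (qform (drsubmx N) e / s) by field.
have : - 1 <= qform (drsubmx N) e / s.
  by move: ab_ge0; rewrite -/s ler_pdivlMr // mulN1r; lra.
have := sqr_ge0 (bform S a v); nra.
Qed.

End QuadraticMatrixInequality.

(** * Stabilization of all compatible systems *)

Section Stabilization.
Variables (R : realType) (n m T : nat).
Variables (Phi : 'M[R]_(n + T)) (B : 'M[R]_(n, m)).
Variables (U : 'M[R]_(m, T)) (X : 'M[R]_(n, T.+1)).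
Hypothesis symPhi : Phi^T = Phi.

Let N := dataN Phi B U X.

Lemma dataN_sym : N^T = N.
Proof. by rewrite /N /dataN !trmx_mul trmxK symPhi mulmxA. Qed.

Lemma qform_dataN a b : qform N (col_mx a b) =
  qform Phi (col_mx a ((Xplus X - B *m U)^T *m a - (Xminus X)^T *m b)).
Proof.
rewrite /N /dataN bform_mul tr_block_mx mul_block_col trmx1 trmx0 mul1mx mul0mx.
by rewrite addr0 [(- _)^T]linearN mulNmx.
Qed.

Lemma compatibleE A :
  compatible Phi B U X A <-> forall v, 0 <= qform N (col_mx v (A^T *m v)).
Proof.
have E v : qform ((col_mx 1%:M (Xplus X - A *m Xminus X - B *m U)^T)^T *m Phi *m
    col_mx 1%:M (Xplus X - A *m Xminus X - B *m U)^T) v =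
    qform N (col_mx v (A^T *m v)).
  rewrite qform_dataN bform_mul trmxK mul_col_mx mul1mx addrAC linearB /=.
  by rewrite mulmxBl [(A *m _)^T]trmx_mul mulmxA.
split=> [[_ ge0] v|ge0]; first by rewrite -E; exact: ge0.
split=> [|v]; last by have := ge0 v; rewrite -E.
by rewrite !trmx_mul !trmxK symPhi mulmxA.
Qed.

(** The data see [A] only through [A X_-]. *)
Lemma compatible_shift A (a b : 'cV[R]_n) t :
  (Xminus X)^T *m b = 0 -> compatible Phi B U X A ->
  compatible Phi B U X (A + t *: (a *m b^T)).
Proof.
move=> Xb0; rewrite /compatible mulmxDl -scalemxAl -mulmxA.
by rewrite -[b^T *m _]trmxK trmx_mul trmxK Xb0 trmx0 mulmx0 scaler0 addr0.
Qed.

(** The matrix of [(a, b) |-> P(a) - P(F^T a + b)], where [F] stands for [B K]: on the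
    graph of [A^T] it is the Lyapunov decrease of [A + F]. *)
Definition lyapunov_mx (P F : 'M[R]_n) : 'M[R]_(n + n) :=
  col_mx 1%:M 0 *m P *m (col_mx 1%:M 0)^T - col_mx F 1%:M *m P *m (col_mx F 1%:M)^T.

Lemma qform_lyapunov P F a b :
  qform (lyapunov_mx P F) (col_mx a b) = qform P a - qform P (F^T *m a + b).
Proof.
rewrite /lyapunov_mx bform_add bform_opp !bform_mul !tr_col_mx !mul_row_col.
by rewrite trmx1 trmx0 !mul1mx mul0mx addr0.
Qed.

Lemma qform_closed_loop (P F A : 'M[R]_n) v :
  qform (P - (A + F) *m P *m (A + F)^T) v =
  qform (lyapunov_mx P F) (col_mx v (A^T *m v)).
Proof.
by rewrite qform_lyapunov bform_add bform_opp bform_mul linearD /= mulmxDl addrC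
  [A^T *m v + _]addrC addrC.
Qed.

Lemma closed_loop_posdefE (P F A : 'M[R]_n) : P^T = P ->
  posdef (P - (A + F) *m P *m (A + F)^T) <->
  forall v, v != 0 -> 0 < qform (lyapunov_mx P F) (col_mx v (A^T *m v)).
Proof.
move=> symP; split=> [[_ gt0] v /gt0|gt0]; first by rewrite -qform_closed_loop.
split=> [|v /gt0]; last by rewrite -qform_closed_loop.
by rewrite linearB /= !trmx_mul trmxK symP mulmxA.
Qed.

(** The Schur complement, as completion of the square in the last variable [c]:
    the two blocks [K P] and [P] of the last column combine into the
    cross term [2 P((BK)^T a + b, c)]. *)
Lemma qform_lmi P K alpha beta a b c : P^T = P ->
  qform (lmi Phi B U X P (K *m P) alpha beta) (col_mx (col_mx a b) c) =
  qform (lyapunov_mx P (B *m K)) (col_mx a b)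
  + qform P ((B *m K)^T *m a + b + c)
  - beta * qform 1%:M a - alpha * qform N (col_mx a b).
Proof.
move=> symP; rewrite qform_lyapunov /lmi bform_add bform_opp bform_scale -/N.
rewrite !bform_block bform_col bform_row !bform0 bform_add bform_opp bform_scalar.
rewrite mulmxA bform_mull (trmx_mul K P) symP -mulmxA -trmx_mul bform_mulr.
set h := _ *m a; rewrite !(bformDl, bformDr).
rewrite (bformC symP c h) (bformC symP c b); ring.
Qed.

Lemma lmi_sym P L alpha beta : P^T = P ->
  (lmi Phi B U X P L alpha beta)^T = lmi Phi B U X P L alpha beta.
Proof.
move=> symP; rewrite /lmi linearB linearZ /= !tr_block_mx -/N dataN_sym.
rewrite linearB /= tr_scalar_mx tr_col_mx tr_row_mx !trmx_mul !trmxK symP.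
by rewrite !trmx0.
Qed.

(** Otherwise [A + t a b^T] is compatible for all [t], and its closed loop
    carries [a] to an affine function of [t] with direction [b]: its
    [P]-norm exceeds that of [a] for large [t]. *)
Lemma Xminus_ker_trivial (P F A : 'M[R]_n) (a b : 'cV[R]_n) :
  posdef P -> compatible Phi B U X A ->
  (forall A, compatible Phi B U X A ->
     posdef (P - (A + F) *m P *m (A + F)^T)) ->
  a != 0 -> (Xminus X)^T *m b = 0 -> b = 0.
Proof.
move=> P_pos A_comp stab a0 Xb0; apply/eqP; apply: contraT => b0.
pose f := F^T *m a + A^T *m a.
have bounded s : qform P (f + s *: b) < qform P a.
  pose t := s / qform 1%:M a.
  have /stab/closed_loop_posdefE := compatible_shift a t Xb0 A_comp.
  move=> /(_ P_pos.1 _ a0); rewrite qform_lyapunov subr_gt0.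
  rewrite linearD linearZ /= trmx_mul trmxK mulmxDl addrA -scalemxAl -mulmxA.
  rewrite [a^T *m a]mx11_scalar mul_mx_scalar scalerA.
  have -> : (a^T *m a) ord0 ord0 = qform 1%:M a by rewrite /bform mulmx1.
  by rewrite /t divfK // gt_eqF // qform1_gt0.
have Pb := P_pos.2 b b0; have Pf := posdef_ge0 f P_pos.
have Pa := posdef_ge0 a P_pos; rewrite -/(qform P b) in Pb.
(* Summing the bounds at s and -s gives s^2 P(b) < P(a), false for this s. *)
pose s := 1 + qform P a / qform P b.
have sE : s * qform P b = qform P b + qform P a by rewrite /s mulrDl mul1r divfK ?gt_eqF.
have s_ge1 : 1 <= s by rewrite lerDl divr_ge0 // ltW.
have := bounded s; have := bounded (- s); rewrite !qform_pencil sqrrN.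
have : s * qform P b <= s ^+ 2 * qform P b.
  by rewrite ler_pM2r // expr2 ler_peMr // (le_trans ler01).
rewrite sE; lra.
Qed.

(** Evaluate the LMI at [(v, A^T v, c)] with the [c] that cancels the completed square. *)
Lemma lmi_stabilizes P K alpha beta : posdef P -> 0 <= alpha -> 0 < beta ->
  psd (lmi Phi B U X P (K *m P) alpha beta) ->
  forall A, compatible Phi B U X A ->
    posdef (P - (A + B *m K) *m P *m (A + B *m K)^T).
Proof.
move=> P_pos alpha_ge0 beta_gt0 [_ lmi_ge0] A /compatibleE A_comp.
apply/(closed_loop_posdefE _ _ P_pos.1) => v v0.
have := lmi_ge0 (col_mx (col_mx v (A^T *m v)) (- ((B *m K)^T *m v + A^T *m v))).
rewrite -/(qform _ _) qform_lmi ?P_pos.1 // subrr bform0l addr0.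
have := mulr_ge0 alpha_ge0 (A_comp v).
have := mulr_gt0 beta_gt0 (qform1_gt0 v0); lra.
Qed.

(** The S-lemma for [M] and [N] bounds [M - alpha N] below by
    [beta (|a|^2 + |b|^2)], hence by [beta |a|^2]; its hypothesis on vectors
    [(0, b)] holds because [N] is negative there, and on the others by interpolation. *)
Lemma stabilizing_lmi P K A0 : posdef P -> compatible Phi B U X A0 ->
  (forall c : 'cV[R]_T, c != 0 -> qform Phi (col_mx 0 c) < 0) ->
  (forall A, compatible Phi B U X A ->
    posdef (P - (A + B *m K) *m P *m (A + B *m K)^T)) ->
  exists alpha beta, [/\ 0 <= alpha, 0 < beta &
    psd (lmi Phi B U X P (K *m P) alpha beta)].
Proof.
move=> P_pos A0_comp Phi22_neg stab.
have M_gt0 z : z != 0 -> 0 <= qform N z -> 0 < qform (lyapunov_mx P (B *m K)) z.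
  rewrite -[z]vsubmxK; set a := usubmx z; set b := dsubmx z => z0 Nz.
  (* Some nonzero vector of R^n, on which the kernel argument is run. *)
  have [w w0] : exists w : 'cV[R]_n, w != 0.
    have [a0|] := eqVneq a 0; last by exists a.
    by exists b; apply: contraNneq z0 => b0; rewrite a0 b0 col_mx0.
  have N22_neg c : c != 0 -> qform N (col_mx 0 c) < 0.
    move=> c0; rewrite qform_dataN mulmx0 sub0r; apply: Phi22_neg.
    rewrite oppr_eq0; apply: contra_neq c0.
    exact: Xminus_ker_trivial P_pos A0_comp stab w0.
  have [a0|a0] := eqVneq a 0.
    have b0 : b != 0 by apply: contraNneq z0 => b0; rewrite a0 b0 col_mx0.
    by move: Nz; rewrite a0 leNgt N22_neg.
  have A0_ge0 := (compatibleE A0).1 A0_comp.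
  have [A <- A_ge0] := qmi_interpolation dataN_sym N22_neg A0_ge0 a0 Nz.
  have /stab/closed_loop_posdefE := (compatibleE A).2 A_ge0.
  by apply; first exact: P_pos.1.
have [alpha [beta [alpha_ge0 beta_gt0 le_M]]] := strict_s_lemma M_gt0.
exists alpha, beta; split=> //; split; first exact: lmi_sym P_pos.1.
move=> v; rewrite -/(qform _ v) -[v]vsubmxK -[usubmx v]vsubmxK.
set a := usubmx (usubmx v); set b := dsubmx (usubmx v); set c := dsubmx v.
rewrite qform_lmi ?P_pos.1 //.
have := le_M (col_mx a b); have := posdef_ge0 ((B *m K)^T *m a + b + c) P_pos.
have : qform 1%:M a <= qform 1%:M (col_mx a b).
  by rewrite scalar_mx_block bform_block !bform0 addr0 add0r lerDl qform1_ge0.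
by move/(ler_wpM2l (ltW beta_gt0)); lra.
Qed.

End Stabilization.

(** * Sparsity patterns with one block column *)

(** With a single block column, each prescribed zero block is a set of full rows. *)
Lemma has_sparsity_mulr (R : realType) (m n k : nat) (p : 'I_k -> nat)
    (q : 'I_1 -> nat) (hp : (\sum_i p i)%N = m) (hq : (\sum_j q j)%N = n)
    (sigma : 'M[bool]_(k, 1)) (K : 'M[R]_(m, n)) (Q : 'M[R]_n) :
  has_sparsity hp hq sigma K -> has_sparsity hp hq sigma (K *m Q).
Proof.
case: m / hp K => K; case: n / hq K Q => K Q sparseK i j sigma0.
apply/matrixP => a b; rewrite /block castmx_id !mxE big1 // => c _.
have sigma_c : sigma i (tagnat.sig1 c) = false by rewrite -sigma0 !ord1.
have /matrixP/(_ a (tagnat.sig2 c)) := sparseK _ _ sigma_c.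
by rewrite /block castmx_id !mxE tagnat.sig2K => ->; rewrite mul0r.
Qed.

(** * Equivalence with the linear matrix inequality *)

Lemma compatible_of_trajectory (R : realType) (n m T : nat) (A : 'M[R]_n)
    (B : 'M[R]_(n, m)) (Phi : 'M[R]_(n + T)) (x w : nat -> 'cV[R]_n)
    (u : nat -> 'cV[R]_m) :
  (forall t, (t < T)%N -> x t.+1 = A *m x t + B *m u t + w t) ->
  noise_bound Phi (samples T w) ->
  compatible Phi B (samples T u) (samples T.+1 x) A.
Proof.
move=> traj; rewrite /compatible; congr (noise_bound Phi _).
apply/matrixP => i t.
have AE : (A *m Xminus (samples T.+1 x)) i t = (A *m x t) i ord0.
  by rewrite !mxE; apply: eq_bigr => j _; rewrite !mxE lift_max.
have BE : (B *m samples T u) i t = (B *m u t) i ord0.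
  by rewrite !mxE; apply: eq_bigr => j _; rewrite !mxE.
have XE : Xplus (samples T.+1 x) i t = (A *m x t + B *m u t + w t) i ord0.
  by rewrite !mxE lift0 traj ?mxE.
have subE (C D : 'M[R]_(n, T)) : (C - D) i t = C i t - D i t by rewrite !mxE.
have addE (c d : 'cV[R]_n) : (c + d) i ord0 = c i ord0 + d i ord0 by rewrite !mxE.
by rewrite !subE XE AE BE !addE [LHS]mxE; ring.
Qed.

Theorem mainTheorem2 (R : realType) (n m T r : nat)
    (ns ms : 'I_r -> nat)
    (hns : (\sum_i ns i)%N = n) (hms : (\sum_i ms i)%N = m)
    (As : 'M[R]_n) (B : 'M[R]_(n, m))
    (hB : block_diagonal hns hms B)
    (x w : nat -> 'cV[R]_n) (u : nat -> 'cV[R]_m)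
    (hsys : forall t : nat, (t < T)%N ->
       x t.+1 = As *m x t + B *m u t + w t)
    (X : 'M[R]_(n, T.+1)) (hX : X = samples T.+1 x)
    (U : 'M[R]_(m, T)) (hU : U = samples T u)
    (Phi11 : 'M[R]_n) (Phi12 : 'M[R]_(n, T)) (Phi22 : 'M[R]_T)
    (hPhi11 : Phi11^T = Phi11) (hPhi22 : Phi22^T = Phi22)
    (hPhi22neg : negdef Phi22)
    (Phi : 'M[R]_(n + T)) (hPhi : Phi = block_mx Phi11 Phi12 Phi12^T Phi22)
    (hnoise : noise_bound Phi (samples T w))
    (k l : nat) (p : 'I_k -> nat) (q : 'I_l -> nat)
    (hp : (\sum_i p i)%N = m) (hq : (\sum_j q j)%N = n)
    (sigma : 'M[bool]_(k, l)) (hl : l = 1%N) :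
  informative Phi B U X hp hq sigma <->
  exists (P : 'M[R]_n) (L : 'M[R]_(m, n)) (alpha beta : R),
    [/\ posdef P, has_sparsity hp hq sigma L, 0 <= alpha, 0 < beta &
        psd (lmi Phi B U X P L alpha beta)].
Proof.
have symPhi : Phi^T = Phi by rewrite hPhi tr_block_mx trmxK hPhi11 hPhi22.
have As_comp : compatible Phi B U X As.
  by rewrite hU hX; exact: compatible_of_trajectory hnoise.
have Phi22_neg (c : 'cV[R]_T) : c != 0 -> qform Phi (col_mx 0 c) < 0.
  move=> c0; rewrite hPhi bform_block !(bform0l, bform0r) !add0r.
  by rewrite -oppr_gt0 -bform_opp; exact: hPhi22neg.2.
subst l.
split=> [[K [P [sparseK P_pos stab]]]|[P [L [alpha [beta]]]]].
  have [alpha [beta [alpha_ge0 beta_gt0 lmi_psd]]] :=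
    stabilizing_lmi symPhi P_pos As_comp Phi22_neg stab.
  exists P, (K *m P), alpha, beta; split=> //; exact: has_sparsity_mulr.
case=> P_pos sparseL alpha_ge0 beta_gt0 lmi_psd.
exists (L *m invmx P), P; split=> //; first exact: has_sparsity_mulr.
apply: (lmi_stabilizes symPhi P_pos alpha_ge0 beta_gt0).
by rewrite mulmxKV // posdef_unitmx.
Qed.
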